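(* Let $n$ be a positive integer. The number $V_n$ of types of virtual $n$-crossings, considered up to rotation, is $$V_n = \frac{1}{n}\sum_{d \mid n} \varphi\left(\frac{n}{d}\right) \sum_{k=1}^{d} \binom{d-1}{k-1}\frac{d!}{k!}\left(\frac{n}{d}\right)^{d-k},$$ where the outer sum is over the positive divisors $d$ of $n$ and $\varphi$ is Euler's totient function.
   Context: A virtual $n$-crossing consists of $n$ unoriented straight strands $\alpha_1,\dots,\alpha_n$, labeled in clockwise order, through a common point in the plane. Each pair of distinct strands crosses either classically or virtually, subject to the validity condition that no three strands have exactly one virtual pair and two classical pairs among their three pairs; equivalently, the relation ''$\alpha_i = \alpha_j$ or $\alpha_i,\alpha_j$ cross classically'' is an equivalence relation on $\{\alpha_1,\dots,\alpha_n\}$. The strands pass through the crossing at distinct heights, but heights matter only for determining which strand is over in each classically crossing pair. Thus a labeled virtual $n$-crossing is the same as a partition of $\{\alpha_1,\dots,\alpha_n\}$ into nonempty parts together with a linear order (by height) on each part; the parts themselves are not ordered. Two labeled virtual $n$-crossings are the same up to rotation if one is obtained from the other by a cyclic shift of labels $\alpha_i \mapsto \alpha_{i+r}$ (indices modulo $n$). $V_n$ denotes the number of equivalence classes of labeled virtual $n$-crossings under rotation. *)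

(* Defs.v *)
From mathcomp Require Import all_boot.

Set Implicit Arguments.
Unset Strict Implicit.
Unset Printing Implicit Defensive.

Definition linear_order_on (T : finType) (B : {set T}) (le : rel T) : bool :=
  [&& [forall x in B, forall y in B, le x y || le y x],
      [forall x in B, forall y in B, (le x y && le y x) ==> (x == y)] &
      [forall x in B, forall y in B, forall z in B,
         (le x y && le y z) ==> le x z]].

(* The strands alpha_1, ..., alpha_n are numbered 0, ..., n-1. The first
   component is the set of parts; the second is the union of the height orders
   of the parts: (i, j) belongs to it when i and j are in the same part and i
   is not above j. *)
Definition crossing_data (n : nat) : finType :=
  ({set {set 'I_n}} * {set 'I_n * 'I_n})%type.

(* The last clause forbids comparisons across parts, so that each partition
   with a linear order on every part is represented exactly once. *)
Definition labeled_crossings (n : nat) : {set crossing_data n} :=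
  [set c : crossing_data n |
    [&& partition c.1 [set: 'I_n],
        [forall B in c.1, linear_order_on B (fun i j => (i, j) \in c.2)] &
        c.2 \subset \bigcup_(B in c.1) setX B B]].

Definition shift_strand (n r : nat) : 'I_n -> 'I_n := iter r (@ordS n).

Lemma val_shift_strand n r (i : 'I_n) : val (shift_strand r i) = (i + r) %% n.
Proof.
elim: r => [|r IHr] /=; first by rewrite addn0 modn_small.
by rewrite [nat_of_ord _]IHr -addn1 modnDml addn1 addnS.
Qed.

Definition rotate_crossing (n r : nat) (c : crossing_data n) :
    crossing_data n :=
  ([set shift_strand r @: B | B : {set 'I_n} in c.1],
   [set (shift_strand r p.1, shift_strand r p.2) | p in c.2]).

(* Shifts are n-periodic, so bounding r by n loses nothing. *)
Definition same_up_to_rotation (n : nat) : rel (crossing_data n) :=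
  fun c c' => [exists r : 'I_n, c' == rotate_crossing r c].

Definition virtual_crossing_types (n : nat) : {set {set crossing_data n}} :=
  equivalence_partition (@same_up_to_rotation n) (labeled_crossings n).

Definition V (n : nat) : nat := #|virtual_crossing_types n|.

(* Agreement with the description of a crossing pair by pair. A diagram is
   given by the pairs (i, j) that cross classically with i over j. *)

Definition over_pairs (n : nat) (c : crossing_data n) : {set 'I_n * 'I_n} :=
  [set p | ((p.2, p.1) \in c.2) && (p.1 != p.2)].

Definition classical (n : nat) (O : {set 'I_n * 'I_n}) (i j : 'I_n) : bool :=
  ((i, j) \in O) || ((j, i) \in O).

Definition crossing_diagram (n : nat) (O : {set 'I_n * 'I_n}) : Prop :=
  (forall i j k : 'I_n, uniq [:: i; j; k] ->
     ~ [/\ classical O i j, classical O j k & ~~ classical O i k]) /\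
  (exists2 h : 'I_n -> nat, injective h &
     forall i j, (i, j) \in O -> h j < h i).

Lemma linear_order_onP (T : finType) (B : {set T}) (le : rel T) :
  reflect [/\ {in B &, total le}, {in B &, antisymmetric le} &
              {in B & &, transitive le}]
          (linear_order_on B le).
Proof.
apply: (iffP and3P) => -[t a tr]; split.
- by move=> x y Bx By; move/forall_inP/(_ x Bx)/forall_inP/(_ y By): t.
- move=> x y Bx By le2.
  by move/forall_inP/(_ x Bx)/forall_inP/(_ y By)/implyP/(_ le2)/eqP: a.
- move=> y x z By Bx Bz xy yz; move/forall_inP/(_ x Bx)/forall_inP/(_ y By): tr.
  by move/forall_inP/(_ z Bz)/implyP; apply; rewrite xy.
- by apply/forall_inP=> x Bx; apply/forall_inP=> y By; apply: t.
- apply/forall_inP=> x Bx; apply/forall_inP=> y By.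
  by apply/implyP=> le2; apply/eqP/a.
- apply/forall_inP=> x Bx; apply/forall_inP=> y By; apply/forall_inP=> z Bz.
  by apply/implyP=> /andP[xy]; apply: (tr y).
Qed.

Lemma labeled_crossingsP (n : nat) (c : crossing_data n) :
  c \in labeled_crossings n ->
  [/\ partition c.1 [set: 'I_n],
      forall i, (i, i) \in c.2,
      forall i j, (i, j) \in c.2 -> (j, i) \in c.2 -> i = j,
      forall i j k, (i, j) \in c.2 -> (j, k) \in c.2 -> (i, k) \in c.2 &
      forall i j, (j \in pblock c.1 i) = ((i, j) \in c.2) || ((j, i) \in c.2)].
Proof.
rewrite inE => /and3P[partP /forall_inP lin /subsetP sub].
have [/eqP covP tiP _] := and3P partP.
have cov i : i \in cover c.1 by rewrite covP inE.
have PB i : pblock c.1 i \in c.1 by apply: pblock_mem.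
have Bi i : i \in pblock c.1 i by rewrite mem_pblock.
have same i j : (i, j) \in c.2 -> pblock c.1 i = pblock c.1 j.
  move/sub/bigcupP=> [B BP]; rewrite inE /= => /andP[iB jB].
  by rewrite !(def_pblock tiP BP).
have inB i j : (i, j) \in c.2 -> j \in pblock c.1 i.
  by move/same->.
split=> //.
- move=> i; have /linear_order_onP[t _ _] := lin _ (PB i).
  by have:= t i i (Bi i) (Bi i); rewrite orbb.
- move=> i j ij ji; have /linear_order_onP[_ a _] := lin _ (PB i).
  by apply: a (Bi i) (inB _ _ ij) _; rewrite ij.
- move=> i j k ij jk; have /linear_order_onP[_ _ tr] := lin _ (PB i).
  apply: (tr j i k) => //; first exact: inB.
  by rewrite (same _ _ ij); apply: inB.
- move=> i j; apply/idP/idP => [jB|/orP[/inB //|/same <- //]].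
  by have /linear_order_onP[t _ _] := lin _ (PB i); apply: t.
Qed.

Lemma over_pairs_inj (n : nat) :
  {in labeled_crossings n &, injective (@over_pairs n)}.
Proof.
move=> [P le] [P' le'].
move=> /labeled_crossingsP /= [pP rf _ _ pb] /labeled_crossingsP /= [pP' rf' _ _ pb'].
move/setP=> eqO.
have eq_le i j : ((i, j) \in le) = ((i, j) \in le').
  have:= eqO (j, i); rewrite !inE /=.
  by case: (eqVneq j i) => [->|_]; rewrite ?rf ?rf' // !andbT.
congr (_, _); last by apply/setP=> -[i j].
rewrite -(equivalence_partition_pblock pP) -(equivalence_partition_pblock pP').
apply: eq_imset => i; apply/setP=> j.
by rewrite !inE pb pb' !eq_le.
Qed.

Lemma over_pairsP (n : nat) (O : {set 'I_n * 'I_n}) :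
  (exists2 c, c \in labeled_crossings n & over_pairs c = O) <->
  crossing_diagram O.
Proof.
split=> [[[P le] /labeled_crossingsP /= [pP rf anti tr pb] <-{O}] | [val [h hI hO]]].
  have [/eqP covP tiP _] := and3P pP.
  have cl i j : i != j -> classical (over_pairs (P, le)) i j = (j \in pblock P i).
    by move=> ij; rewrite /classical !inE /= pb [j == i]eq_sym ij !andbT orbC.
  split=> [i j k|].
    rewrite /= !inE andbT negb_or => /andP[/andP[ij ik] jk].
    rewrite !cl // => -[jB kB /negP[]].
    by rewrite -(same_pblock tiP jB).
  pose rk i := #|[set j | (j, i) \in le]|.
  have rk_le i : rk i < n.+1 by rewrite ltnS -[leqRHS]card_ord max_card.
  have rk_lt i j : (j, i) \in le -> j != i -> rk j < rk i.
    move=> ji nji; apply/proper_card/properP; split.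
      by apply/subsetP=> k; rewrite !inE => /tr; apply.
    exists i; rewrite !inE ?rf //; apply/negP=> ij.
    by rewrite (anti _ _ ij ji) eqxx in nji.
  have cov i : i \in cover P by rewrite covP inE.
  exists (fun i => enum_rank (pblock P i) * n.+1 + rk i).
    move=> i j eqh.
    have eqr : rk i = rk j.
      move: (congr1 (modn^~ n.+1) eqh).
      by rewrite /= !modnMDl !modn_small.
    have eqb : pblock P i = pblock P j.
      apply/enum_rank_inj/val_inj => /=; move/eqP: eqh.
      by rewrite eqr eqn_add2r eqn_pmul2r // => /eqP.
    have: j \in pblock P i by rewrite eqb mem_pblock.
    rewrite pb; case: (eqVneq i j) => // nij /orP[ij|ji].
      by have:= rk_lt _ _ ij nij; rewrite eqr ltnn.
    by rewrite eq_sym in nij; have:= rk_lt _ _ ji nij; rewrite eqr ltnn.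
  move=> i j; rewrite inE /= => /andP[ji nij].
  have -> : pblock P j = pblock P i.
    by apply: same_pblock => //; rewrite pb ji orbT.
  by rewrite ltn_add2l rk_lt // eq_sym.
pose R i j := (i == j) || classical O i j.
have Oir i : (i, i) \notin O by apply/negP=> /hO; rewrite ltnn.
have clC i j : classical O i j = classical O j i by rewrite /classical orbC.
have Rtr i j k : R i j -> R j k -> R i k.
  rewrite /R; case: (eqVneq i j) => [-> //|nij] /= ij.
  case: (eqVneq j k) => [<- _|njk /= jk]; first by rewrite ij orbT.
  case: (eqVneq i k) => //= nik; apply/negPn/negP=> nc.
  by apply: (val i j k) => //=; rewrite !inE negb_or nij nik njk.
have Rsym i j : R i j = R j i by rewrite /R eq_sym clC.
have Req : {in [set: 'I_n] & &, equivalence_rel R}.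
  move=> i j k _ _ _; split; first by rewrite /R eqxx.
  by move=> ij; apply/idP/idP; apply: Rtr => //; rewrite Rsym.
pose le := [set p : 'I_n * 'I_n | (p.1 == p.2) || ((p.2, p.1) \in O)].
have partP := equivalence_partitionP Req.
exists (equivalence_partition R [set: 'I_n], le); last first.
  apply/setP=> -[i j]; rewrite !inE /= eq_sym.
  by case: (eqVneq i j) => [->|_] /=; rewrite ?andbT // (negPf (Oir j)).
have leh i j : (i, j) \in le -> h i <= h j.
  by rewrite inE /= => /orP[/eqP-> //|/hO/ltnW].
have le_of i j : R i j -> h i <= h j -> (i, j) \in le.
  rewrite inE /R /= /classical => /orP[-> //|/orP[/hO lt|->]]; last by rewrite orbT.
  by rewrite leqNgt lt.
have leR i j : (i, j) \in le -> R i j.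
  by rewrite inE /= /R /classical => /orP[->|->] //; rewrite !orbT.
rewrite inE /= partP /=; apply/andP; split.
  apply/forall_inP=> B /imsetP[b _ ->]; apply/linear_order_onP; split.
  - move=> i j /setIdP[_ bi] /setIdP[_ bj].
    have ij: R i j by apply: Rtr bj; rewrite Rsym.
    apply/orP; have [hij|/ltnW hij] := leqP (h i) (h j); [left|right].
      exact: le_of.
    by apply: le_of => //; rewrite Rsym.
  - move=> i j _ _ /andP[/leh ij /leh ji]; apply/hI/eqP.
    by rewrite eqn_leq ij.
  - move=> j i k _ _ _ ij jk; apply: le_of; first exact: Rtr (leR _ _ ij) (leR _ _ jk).
    exact: leq_trans (leh _ _ ij) (leh _ _ jk).
apply/subsetP=> -[i j] ij; apply/bigcupP.
exists [set k in [set: 'I_n] | R i k]; first by apply/imsetP; exists i.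
by rewrite !inE /= (leR i j ij) /R eqxx.
Qed.

(* Main.v *)
(* By Burnside's lemma, n V_n is the sum over the rotations g of the number of
   labeled crossings fixed by g. A labeled crossing amounts to the order "in the
   same part and not above", a disjoint union of chains, one for each part. If g
   has order m, then H = <[g]> acts freely on the n = d m strands, and also on
   the chains of an H-invariant order, because a finite chain has no nontrivial
   automorphism. Let W_k be the number of H-invariant orders with k orbits of
   chains. Such an order has m k chains, and putting one of them just below
   another one from a different orbit (together with all H-translates) gives an
   order with k - 1 orbits of chains and a marked non-maximal strand; cutting
   above the marked strand and its translates is the inverse operation. Hence
   W_k * m k * (m k - m) = W_(k-1) * (m d - m (k - 1)), and W_d = 1, so that
   W_k = 'C(d-1, k-1) * d! / k! * m ^ (d - k). *)
Require Import Defs.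
From mathcomp Require Import all_boot all_order all_algebra.
From mathcomp Require Import all_fingroup cyclic.
From mathcomp Require Import ring.

Set Implicit Arguments.
Unset Strict Implicit.
Unset Printing Implicit Defensive.

Import GRing.Theory Num.Theory.

(** * Finite disjoint unions of chains, their tops and bottoms *)

Section ChainOrders.

Variable T : finType.
Implicit Types (R : {set T * T}) (x y z a b : T).

Definition same_chain R x y := ((x, y) \in R) || ((y, x) \in R).

(* The last clause makes [same_chain] transitive: [R] is a disjoint union of
   chains. *)
Definition chain_order R : bool :=
  [&& [forall x, (x, x) \in R],
      [forall x, forall y, ((x, y) \in R) && ((y, x) \in R) ==> (x == y)],
      [forall x, forall y, forall z,
         ((x, y) \in R) && ((y, z) \in R) ==> ((x, z) \in R)] &
      [forall x, forall y, forall z,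
         ((x, y) \in R) && ((x, z) \in R) || ((y, x) \in R) && ((z, x) \in R)
         ==> same_chain R y z]].

Lemma chain_orderP R :
  reflect [/\ forall x, (x, x) \in R,
              forall x y, (x, y) \in R -> (y, x) \in R -> x = y,
              forall y x z, (x, y) \in R -> (y, z) \in R -> (x, z) \in R,
              forall x y z, (x, y) \in R -> (x, z) \in R -> same_chain R y z &
              forall x y z, (y, x) \in R -> (z, x) \in R -> same_chain R y z]
          (chain_order R).
Proof.
apply: (iffP and4P) => [[/forallP r a t f] | [r a t u d]]; split=> //.
- move=> x y xy yx; apply/eqP.
  by move/'forall_'forall_implyP: a; apply; rewrite xy.
- move=> y x z xy yz.
  by move/'forall_'forall_'forall_implyP/(_ x y z): t; apply; rewrite xy yz.
- move=> x y z xy xz.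
  by move/'forall_'forall_'forall_implyP/(_ x y z): f; apply; rewrite xy xz.
- move=> x y z xy xz; move/'forall_'forall_'forall_implyP/(_ x y z): f.
  by apply; rewrite xy xz orbT.
- by apply/forallP.
- by apply/'forall_'forall_implyP => x y /andP[xy yx]; apply/eqP/a.
- by apply/'forall_'forall_'forall_implyP => x y z /andP[]; apply: t.
- by apply/'forall_'forall_'forall_implyP => x y z /orP[] /andP[];
    [apply: u | apply: d].
Qed.

Lemma same_chainC R x y : same_chain R x y = same_chain R y x.
Proof. by rewrite /same_chain orbC. Qed.

Lemma same_chain_trans R y x z :
  chain_order R -> same_chain R x y -> same_chain R y z -> same_chain R x z.
Proof.
case/chain_orderP=> _ _ t u d /orP[xy|yx] /orP[yz|zy].
- by apply/orP; left; apply: t yz.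
- exact: d xy zy.
- exact: u yx yz.
- by apply/orP; right; apply: t yx.
Qed.

Definition chain_of R x := [set y | same_chain R x y].

Lemma eq_chain_of R x y :
  chain_order R -> (chain_of R x == chain_of R y) = same_chain R x y.
Proof.
move=> cR; apply/eqP/idP => [/setP/(_ y)|xy].
  by case/chain_orderP: (cR) => r _ _ _ _; rewrite !inE /same_chain r => ->.
apply/setP=> z; rewrite !inE; apply/idP/idP; last exact: same_chain_trans.
by apply: same_chain_trans => //; rewrite same_chainC.
Qed.

Definition chains R := [set chain_of R x | x in T].

(** Reversing the order turns tops into bottoms and upward forks into downward ones, so each such
    fact is proved only once. *)
Definition converse R := [set p : T * T | (p.2, p.1) \in R].

Lemma in_converse R x y : ((x, y) \in converse R) = ((y, x) \in R).
Proof. by rewrite inE. Qed.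

Lemma same_chain_converse R x y : same_chain (converse R) x y =
  same_chain R x y.
Proof. by rewrite /same_chain !in_converse orbC. Qed.

Lemma converse_chain R : chain_order R -> chain_order (converse R).
Proof.
case/chain_orderP=> r a t u d; apply/chain_orderP;
  split=> [x|x y|y x z|x y z|x y z].
- by rewrite inE.
- by rewrite !inE => /= yx xy; apply: a.
- by rewrite !inE => /= yx zy; apply: t yx.
- by rewrite /same_chain !inE => /= yx zx; rewrite orbC; apply: d zx.
- by rewrite /same_chain !inE => /= yx zx; rewrite orbC; apply: u zx.
Qed.

Lemma chains_converse R : chains (converse R) = chains R.
Proof.
by apply: eq_imset => x; apply/setP=> y; rewrite !inE same_chain_converse.
Qed.

Definition tops R := [set x | [forall y, ((x, y) \in R) ==> (y == x)]].

Lemma topsP R x :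
  reflect (forall y, (x, y) \in R -> y = x) (x \in tops R).
Proof.
rewrite inE; apply: (iffP 'forall_implyP) => H y /H; first by move/eqP.
by move/eqP.
Qed.

Definition bots R := tops (converse R).

Lemma botsP R x :
  reflect (forall y, (y, x) \in R -> y = x) (x \in bots R).
Proof.
by apply: (iffP (topsP _ _)) => H y; have:= H y; rewrite inE.
Qed.

Lemma top_cmp R x y : x \in tops R -> same_chain R x y -> (y, x) \in R.
Proof. by move/topsP=> Tx /orP[xy|//]; move: xy (xy) => /Tx ->. Qed.

Lemma top_above R x :
  chain_order R -> exists2 t, t \in tops R & (x, t) \in R.
Proof.
case/chain_orderP=> r a t u d.
(* Among the elements above [x], one with the most elements below it is a top: anything strictly
   above it would have more. *)
case: (arg_maxnP (P := fun y => (x, y) \in R)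
  (fun y => #|[set w | (w, y) \in R]|) (r x)) => y xy maxy.
exists y => //; apply/topsP => z yz; apply/eqP/negPn/negP => nzy.
have /maxy /= := t _ _ _ xy yz; rewrite leqNgt => /negP[]; apply: proper_card.
apply/properP; split; first by apply/subsetP=> w; rewrite !inE => /t; apply.
exists z; rewrite !inE ?r //; apply/negP=> zy.
by rewrite (a _ _ yz zy) eqxx in nzy.
Qed.

(** The successor is an element strictly above [x] with the fewest elements below it. It is the
    least such element because any two elements above [x] are comparable. *)
Lemma succ_above R x : chain_order R -> x \notin tops R ->
  exists2 y, ((x, y) \in R) && (y != x) &
    forall z, (x, z) \in R -> z != x -> (y, z) \in R.
Proof.
case/chain_orderP=> r a t u d; rewrite inE negb_forall => /existsP[y0].
rewrite negb_imply => y0P.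
case: (arg_minnP (fun y => #|[set w | (w, y) \in R]|)
        (P := fun y => ((x, y) \in R) && (y != x)) y0P) => y /andP[xy nyx] miny.
exists y; first by rewrite xy.
move=> z xz nzx; case/orP: (u _ _ _ xy xz) => // zy.
have [->|nzy] := eqVneq z y; first exact: r.
have /miny : ((x, z) \in R) && (z != x) by rewrite xz.
rewrite leqNgt => /negP[]; apply: proper_card.
apply/properP; split; first by apply/subsetP=> w; rewrite !inE => /t; apply.
exists y; rewrite !inE ?r //; apply/negP=> yz.
by rewrite (a _ _ yz zy) eqxx in nzy.
Qed.

Lemma top_inj R x y :
  x \in tops R -> y \in tops R -> same_chain R x y -> x = y.
Proof. by move=> Tx /topsP Ty /(top_cmp Tx) /Ty. Qed.

Lemma chain_of_tops R : chain_order R -> chain_of R @: tops R = chains R.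
Proof.
move=> cR; apply/setP=> B; apply/imsetP/imsetP => [[x _ ->]|[x _ ->]];
  first by exists x.
have [t Tt xt] := top_above x cR; exists t => //; apply/eqP.
by rewrite eq_chain_of // /same_chain xt.
Qed.

Lemma chain_of_tops_inj R : chain_order R ->
  {in tops R &, injective (chain_of R)}.
Proof.
by move=> cR x y Tx Ty /eqP; rewrite eq_chain_of //; apply: top_inj.
Qed.

Lemma card_tops R : chain_order R -> #|tops R| = #|chains R|.
Proof.
by move=> cR; rewrite -chain_of_tops // card_in_imset //;
  apply: chain_of_tops_inj.
Qed.

Lemma card_bots R : chain_order R -> #|bots R| = #|tops R|.
Proof.
by move=> cR; rewrite /bots !card_tops ?converse_chain // chains_converse.
Qed.
End ChainOrders.

(** * Chain orders invariant under a freely acting permutation group *)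

Section Semiregular.

Variables (T : finType) (H : {group {perm T}}).
Implicit Types (R : {set T * T}) (x y z a b : T) (h : {perm T}).

Hypothesis H_semiregular : forall h x, h \in H -> h x = x -> h = 1%g.

Definition perm_invariant R : bool :=
  [forall h in H, forall x, forall y, ((h x, h y) \in R) == ((x, y) \in R)].

Lemma perm_invariantP R :
  reflect {in H, forall h x y, ((h x, h y) \in R) =
    ((x, y) \in R)} (perm_invariant R).
Proof.
apply: (iffP 'forall_implyP) => Rinv h Hh; last first.
  by apply/'forall_'forall_eqP => x y; apply: Rinv.
by move=> x y; apply/eqP; move: x y; apply/'forall_forallP; apply: Rinv.
Qed.

Definition invariant_chain_orders := [set R | chain_order R && perm_invariant
  R].
Local Notation ico := invariant_chain_orders.

Lemma ico_chain R : R \in ico -> chain_order R.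
Proof. by case/setIdP. Qed.

Lemma same_chain_perm R h x y :
  R \in ico -> h \in H -> same_chain R (h x) (h y) = same_chain R x y.
Proof. by rewrite inE /same_chain => /andP[_ /perm_invariantP inv] Hh;
  rewrite !inv. Qed.

(** If [x <= k x], then invariance gives [k x <= k^2 x <= ...], and at the order of [k] this rising
    sequence returns to [x]. Antisymmetry forces [k x = x], and [k] is trivial by freeness. *)
Lemma same_chain_shift R h x : R \in ico -> h \in H ->
  same_chain R x (h x) -> h = 1%g.
Proof.
rewrite inE => /andP[/chain_orderP[r a t _ _] /perm_invariantP inv].
(* If instead [h x <= x], then [x <= h^-1 x], so the inverse of [h] is treated in its place. *)
suff main k : k \in H -> (x, k x) \in R -> k = 1%g.
  move=> Hh /orP[|hx]; first exact: main.
  apply: invg_inj; rewrite invg1; apply: main; rewrite ?groupV //.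
  by rewrite -(inv h) // permKV.
move=> Hk xk; apply: (H_semiregular Hk (x := x)).
have up n : (k x, (k ^+ n.+1)%g x) \in R.
  elim: n => [|n IHn]; first by rewrite expg1.
  by apply: t IHn _; rewrite [X in (_, X)](_ : _ =
    (k ^+ n.+1)%g (k x)) ?inv ?groupX // -permM -expgS.
apply: a => //; have := up (#[k]%g).-1.
by rewrite prednK ?order_gt0 // expg_order perm1.
Qed.

(** [H] acts freely on the chains as well as on the points. *)
Lemma eq_shift R h k x :
  R \in ico -> h \in H -> k \in H -> same_chain R (h x) (k x) -> h = k.
Proof.
move=> icoR Hh Hk c; apply/eqP; rewrite eq_mulgV1; apply/eqP.
apply: invg_inj; rewrite invg1 invMg invgK.
have Hkh : (k * h^-1)%g \in H by rewrite groupM ?groupV.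
apply: (same_chain_shift (x := x) icoR) => //.
by rewrite -(same_chain_perm _ _ icoR Hh) permM permKV.
Qed.

Lemma shift_top R h x : R \in ico -> h \in H -> (h x \in tops R) =
  (x \in tops R).
Proof.
rewrite inE => /andP[_ /perm_invariantP inv] Hh; apply/topsP/topsP => Tx y xy.
  by apply: (@perm_inj _ h); apply: Tx; rewrite inv.
by rewrite -(permKV h y); congr (h _); apply: Tx; rewrite -(inv h) // permKV.
Qed.

Definition orbH x := [set h x | h : {perm T} in H].

Lemma converse_ico R : R \in ico -> converse R \in ico.
Proof.
rewrite !inE => /andP[cR /perm_invariantP inv]; rewrite converse_chain //=.
by apply/perm_invariantP=> h Hh x y; rewrite !inE inv.
Qed.

Lemma card_orbH x : #|orbH x| = #|H|.
Proof.
apply: card_in_imset => h k Hh Hk e; apply/eqP; rewrite eq_mulgV1; apply/eqP.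
apply: (H_semiregular (x := x)); first by rewrite groupM ?groupV.
by rewrite permM e permK.
Qed.

(** * Equivariant joining and cutting of chains *)

Definition apart R x y := [forall h in H, ~~ same_chain R (h x) y].

Lemma apartP R x y :
  reflect {in H, forall h, ~~ same_chain R (h x) y} (apart R x y).
Proof. exact: 'forall_implyP. Qed.

Lemma apart_shift R x y h k : R \in ico -> apart R x y -> h \in H -> k \in H ->
  ~~ same_chain R (h x) (k y).
Proof.
move=> icoR /apartP ap Hh Hk.
have /ap : (h * k^-1)%g \in H by rewrite groupM ?groupV.
by rewrite -(same_chain_perm _ _ icoR Hk) permM permKV.
Qed.

(** [apart] means that the two chains lie in different [H]-orbits. The bottoms that fail it
    correspond, chain by chain, to the translates of [x], which lie in [#|H|] distinct chains. *)
Lemma card_apart R x : R \in ico -> x \in tops R ->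
  #|[set y in bots R | apart R x y]| = #|tops R| - #|H|.
Proof.
move=> icoR Tx; have cR := ico_chain icoR.
rewrite -(card_bots cR) -(card_orbH x).
pose near := [set y in bots R | ~~ apart R x y].
have -> : [set y in bots R | apart R x y] = bots R :\: near.
  by apply/setP=> y; rewrite !inE; case: apart; rewrite ?andbF ?andbT ?andNb.
rewrite cardsD; congr (_ - _).
have /setIidPr-> : near \subset bots R by apply/subsetP=> y;
  rewrite inE => /andP[].
have injo : {in orbH x &, injective (chain_of R)}.
  move=> _ _ /imsetP[h Hh ->] /imsetP[k Hk ->] /eqP; rewrite eq_chain_of //.
  by move=> /(eq_shift icoR Hh Hk) ->.
have cRc := converse_chain cR.
have injn : {in near &, injective (chain_of R)}.
  move=> y z /setIdP[By _] /setIdP[Bz _] /eqP.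
  rewrite eq_chain_of // => yz; apply: top_inj By Bz _.
  by rewrite same_chain_converse.
rewrite -(card_in_imset injo) -(card_in_imset injn); congr #|pred_of_set _|.
apply/setP=> B; apply/imsetP/imsetP => [[y] | [_ /imsetP[h Hh ->] ->]].
  case/setIdP=> By; rewrite negb_forall => /existsP[h].
  rewrite negb_imply negbK => /andP[Hh hy] ->; exists (h x);
    first exact: imset_f.
  by apply/eqP; rewrite eq_chain_of // same_chainC.
have [y By] := top_above (h x) cRc; rewrite inE /= => yh.
have hy : same_chain R (h x) y by rewrite /same_chain yh orbT.
exists y; last by apply/eqP; rewrite eq_chain_of.
rewrite inE By; apply/negP => /apartP/(_ h Hh).
by rewrite hy.
Qed.

(* Puts the chain with top [x] below the chain with bottom [y], and likewise for
   all translates under [H]. *)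
Definition join R x y := R :|:
  [set p : T * T | [exists h in H, ((p.1, h x) \in R) && ((h y, p.2) \in R)]].

Lemma joinP R x y a b :
  reflect ((a, b) \in R \/ exists2 h, h \in H & (a, h x) \in R
    /\ (h y, b) \in R)
          ((a, b) \in join R x y).
Proof.
rewrite !inE; apply: (iffP orP) => -[|]; try by left.
  by case/'exists_andP=> h [Hh /andP[]]; right; exists h.
by case=> h Hh [ax yb]; right; apply/'exists_andP; exists h; rewrite Hh ax.
Qed.

Lemma converse_join R x y : converse (join R x y) = join (converse R) y x.
Proof.
apply/setP=> -[a b]; rewrite inE; apply/joinP/joinP; rewrite !inE /=;
  case; try (by left); case=> h Hh []; rewrite ?inE /= => ? ?; right; exists h;
  by rewrite // ?inE.
Qed.

Lemma join_ico R x y : R \in ico -> x \in tops R -> y \in bots R ->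
  apart R x y -> join R x y \in ico.
Proof.
move=> icoR Tx By ap; rewrite inE.
have := icoR; rewrite inE => /andP[cR /perm_invariantP inv].
have [r a t _ _] := chain_orderP _ cR.
(* No translate of [y] lies below a translate of [x], so two new comparisons never compose. *)
have noJ h k : h \in H -> k \in H -> (h y, k x) \notin R.
  move=> Hh Hk; have := apart_shift icoR ap Hk Hh.
  by rewrite /same_chain negb_or => /andP[].
(* Stated for arbitrary [R'], [x'], [y'], so that downward forks follow by applying it to the
   converse order with [x] and [y] exchanged. *)
have fork R' x' y' : R' \in ico -> x' \in tops R' -> forall a b c,
   (a, b) \in join R' x' y' -> (a, c) \in join R' x' y' ->
     same_chain (join R' x' y') b c.
  move=> icoR' Tx' {}a b c.
  have := icoR'; rewrite inE => /andP[/chain_orderP[_ _ _ u d] _].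
  have sub p q : same_chain R' p q -> same_chain (join R' x' y') p q.
    by rewrite /same_chain !inE => /orP[->|->]; rewrite ?orbT.
  (* As [h x'] is the top of the chain of [a], it is above [p], and the joint at [h] puts [p] below
     [q]. *)
  have mix p q h : h \in H -> (a, p) \in R' -> (a, h x') \in R' ->
    (h y', q) \in R' ->
      (p, q) \in join R' x' y'.
    move=> Hh ap' ahx hyq; apply/joinP; right; exists h => //; split=> //.
    by apply: top_cmp; rewrite ?shift_top //; apply: u ahx ap'.
  case/joinP=> [ab|[h Hh [ahx hyb]]] /joinP[ac|[k Hk [akx kyc]]].
  - by apply: sub; apply: u ab ac.
  - by rewrite /same_chain (mix _ _ k).
  - by rewrite same_chainC /same_chain (mix _ _ h).
  (* Both comparisons pass through joints above [a]; these lie in one chain, hence coincide. *)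
  have e := eq_shift icoR' Hh Hk (u _ _ _ ahx akx).
  by apply: sub; apply: u hyb _; rewrite e.
apply/andP; split.
  apply/chain_orderP; split.
  - by move=> b; apply/joinP; left.
  - move=> b c /joinP[bc|[h Hh [bhx hyc]]] /joinP[cb|[k Hk [ckx kyb]]].
    + exact: a.
    + by case/negP: (noJ k k Hk Hk); apply: t (t _ _ _ kyb bc) _.
    + by case/negP: (noJ h h Hh Hh); apply: t (t _ _ _ hyc cb) _.
    + by case/negP: (noJ h k Hh Hk); apply: t ckx.
  - move=> c b d' /joinP[bc|[h Hh [bhx hyc]]] /joinP[cd|[k Hk [ckx kyd]]];
    apply/joinP.
    + by left; apply: t cd.
    + by right; exists k => //; split=> //; apply: t ckx.
    + by right; exists h => //; split=> //; apply: t cd.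
    + by case/negP: (noJ h k Hh Hk); apply: t ckx.
  - exact: fork.
  - move=> b c d' cb db; have := fork _ y x (converse_ico icoR) By b c d'.
    by rewrite -converse_join !in_converse same_chain_converse; apply.
apply/perm_invariantP=> h Hh b c; apply/joinP/joinP; rewrite inv //.
  case=> [bc|[k Hk [bx yc]]]; [by left | right; exists (k * h^-1)%g].
    by rewrite groupM ?groupV.
  by rewrite !permM -(inv h) // permKV -(inv h Hh (h^-1 _)%g) permKV.
case=> [bc|[k Hk [bx yc]]]; [by left | right; exists (k * h)%g].
  by rewrite groupM.
by rewrite !permM !inv.
Qed.

Lemma tops_join R x y : R \in ico -> x \in tops R -> y \in bots R ->
  apart R x y -> tops (join R x y) = tops R :\: orbH x.
Proof.
move=> icoR Tx By ap; have := icoR; rewrite inE =>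
  /andP[/chain_orderP[r _ _ _ _] inv].
apply/setP=> z; rewrite in_setD; apply/topsP/andP => [Tz|[nz /topsP Tz] b].
  split; last by apply/topsP => b zb; apply: Tz; apply/joinP; left.
  apply/negP => /imsetP[h Hh zh].
  have /Tz e : (z, h y) \in join R x y by apply/joinP; right; exists h;
    rewrite // zh r.
  by have := apart_shift icoR ap Hh Hh; rewrite e -zh /same_chain r.
case/joinP=> [/Tz//|[h Hh [zhx _]]]; case/negP: nz.
by apply/imsetP; exists h; rewrite ?(Tz _ zhx).
Qed.

Lemma card_tops_join R x y : R \in ico -> x \in tops R -> y \in bots R ->
  apart R x y -> #|tops (join R x y)| = #|tops R| - #|H|.
Proof.
move=> icoR Tx By ap; rewrite tops_join // cardsD -(card_orbH x).
congr (_ - #|pred_of_set _|); apply/setIidPr/subsetP => _ /imsetP[h Hh ->].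
by rewrite shift_top.
Qed.

(* Forgets [a <= b] when some translate of [x] satisfies [a <= h x < b]. *)
Definition cut R x :=
  [set p in R | [forall h in H, ((p.1, h x) \in R) ==> ((p.2, h x) \in R)]].

Lemma cutP R x a b :
  reflect ((a, b) \in R /\ {in H, forall h, (a, h x) \in R -> (b, h x) \in R})
          ((a, b) \in cut R x).
Proof.
rewrite inE; apply: (iffP andP) => -[ab C]; split=> //=.
  by move=> h Hh; apply/implyP; move/forall_inP: C; apply.
by apply/forall_inP => h Hh; apply/implyP/C.
Qed.

(** A new comparison goes from below some [h x] to above [h y], which is not below [h x], so the cut
    removes it. An old one starting below [h x] also ends below it, since [h x] is the top of its
    chain in [R]. *)
Lemma join_cutK R x y : R \in ico -> x \in tops R -> y \in bots R ->
  apart R x y -> cut (join R x y) x = R.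
Proof.
move=> icoR Tx By ap; have := icoR; rewrite inE =>
  /andP[/chain_orderP[r a t u d] _].
have noJ h k : h \in H -> k \in H -> (h y, k x) \notin R.
  move=> Hh Hk; have := apart_shift icoR ap Hk Hh.
  by rewrite /same_chain negb_or => /andP[].
apply/setP=> -[b c]; apply/cutP/idP => [[/joinP[//|[h Hh [bhx hyc]]] C]|bc].
  have /joinP[chx|[k Hk [_ kyhx]]] : (c, h x) \in join R x y.
  - by apply: C => //; apply/joinP; left.
  - by case/negP: (noJ h h Hh Hh); apply: t chx.
  - by case/negP: (noJ k h Hk Hh).
split=> [|h Hh /joinP[bhx|[k Hk [_ kyhx]]]]; try by [apply/joinP; left].
  apply/joinP; left; apply: top_cmp; rewrite ?shift_top //.
  exact: u bhx bc.
by case/negP: (noJ k h Hk Hh).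
Qed.

(** Cutting recovers [R] but not the chain put above [x]. The pair [(x, z)] can only come from the
    joint at the identity, which gives [y <= z], and [z] is a bottom. *)
Lemma join_inj R x y z : R \in ico -> x \in tops R ->
  y \in bots R -> apart R x y -> z \in bots R -> apart R x z ->
  join R x y = join R x z -> y = z.
Proof.
move=> icoR Tx By ap Bz apz; have := icoR;
  rewrite inE => /andP[/chain_orderP[r _ _ _ _] _].
move/setP/(_ (x, z)).
have -> : (x, z) \in join R x z.
  by apply/joinP; right; exists 1%g; rewrite ?group1 // !perm1.
have ap1 : ~~ same_chain R x z.
  by have := apart_shift icoR apz (group1 H) (group1 H); rewrite !perm1.
case/joinP=> [xz|[h Hh [xhx hyz]]]; first by case/negP: ap1;
  rewrite /same_chain xz.
have h1 : h = 1%g by apply: (same_chain_shift (x := x) icoR);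
  rewrite // /same_chain xhx.
by move: hyz; rewrite h1 perm1; move/botsP: Bz => /[apply].
Qed.

Lemma cut_ico R x : R \in ico -> cut R x \in ico.
Proof.
rewrite !inE => /andP[/chain_orderP[r a t u d] /perm_invariantP inv].
apply/andP; split.
  apply/chain_orderP; split.
  - by move=> b; apply/cutP; split.
  - by move=> b c /cutP[bc _] /cutP[cb _]; apply: a.
  - move=> b c e /cutP[cb C1] /cutP[be C2]; apply/cutP; split;
    first exact: t be.
    by move=> h Hh /(C1 h Hh); apply: C2.
  (* A comparison that survives the cut leaves every comparison between its ends intact; here the
     lower end is raised, and in the dual case below the upper end is lowered. *)
  - have aux b c e : (b, c) \in R -> (c, e) \in R -> (b, e) \in cut R x ->
       (c, e) \in cut R x.
      move=> bc ce /cutP[_ C]; apply/cutP; split=> // h Hh chx.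
      by apply: C => //; apply: t chx.
    move=> b c e bc be; have [[bcR _] [beR _]] := (cutP _ _ _ _ bc, cutP _ _ _
      _ be).
    case/orP: (u _ _ _ bcR beR) => ce; first by rewrite /same_chain (aux b c e).
    by rewrite /same_chain (aux b e c) // orbT.
  - have aux b c e : (e, b) \in R -> (c, e) \in R -> (c, b) \in cut R x ->
       (c, e) \in cut R x.
      move=> eb ce /cutP[_ C]; apply/cutP; split=> // h Hh chx.
      by apply: t eb _; apply: C.
    move=> b c e cb eb; have [[cbR _] [ebR _]] := (cutP _ _ _ _ cb, cutP _ _ _
      _ eb).
    case/orP: (d _ _ _ cbR ebR) => ce; first by rewrite /same_chain (aux b c e).
    by rewrite /same_chain (aux b e c) // orbT.
apply/perm_invariantP=> h Hh b c; apply/cutP/cutP; rewrite inv // => -[-> C];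
  split=> // k Hk.
  move=> bk; rewrite -(inv h) // -permM; apply: C; first by rewrite groupM.
  by rewrite permM inv.
have Hkh : (k * h^-1)%g \in H by rewrite groupM ?groupV.
move=> bk; rewrite -(inv h^-1)%g ?groupV // permK -permM; apply: C => //.
by rewrite permM -(inv h) // permKV.
Qed.

(** The witness [y] is the immediate successor of [x] in [R]: after the cut it becomes the bottom of
    the upper piece. *)
Lemma cut_succ R x : R \in ico -> x \notin tops R ->
  exists y, [/\ x \in tops (cut R x), y \in bots (cut R x),
                apart (cut R x) x y & join (cut R x) x y = R].
Proof.
move=> icoR nTx; have := icoR; rewrite inE => /andP[cR /perm_invariantP inv].
have [r a t u d] := chain_orderP _ cR.
have [y /andP[xy nyx] miny] := succ_above cR nTx.
have nyxR : (y, x) \notin R by apply: contraNN nyx => yx; rewrite (a _ _ xy yx).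
have cut1 b c : (b, c) \in cut R x -> (b, x) \in R -> (c, x) \in R.
  by case/cutP=> _ /(_ 1%g (group1 H)); rewrite perm1.
have shift1 h : h \in H -> same_chain R x (h x) -> h x = x.
  by move=> Hh /(same_chain_shift icoR Hh) ->; rewrite perm1.
exists y; split.
- apply/topsP=> b xb; apply: a; first by apply: (cut1 x).
  by case/cutP: xb.
- apply/botsP=> b yb; have /cutP[ybR _] := yb.
  have nbx : (b, x) \notin R by apply: contraNN nyxR => /(cut1 _ _ yb).
  have xb : (x, b) \in R by case/orP: (d _ _ _ xy ybR) => // bx;
    rewrite bx in nbx.
  apply: a => //; apply: miny => //.
  by apply: contraNneq nbx => ->.
- apply/apartP=> h Hh; apply/negP=> /orP[] /[dup] /cutP[hR _] c.
    have := d _ _ _ xy hR; move/shift1 => /(_ Hh) e; rewrite e in c.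
    by case/negP: nyxR; apply: cut1 c _.
  have := t _ _ _ xy hR => xh.
  have e : h x = x by apply: shift1; rewrite // /same_chain xh.
  by case/negP: nyxR; rewrite -e.
apply/setP=> -[b c]; apply/joinP/idP => [[/cutP[]//|[h Hh [/cutP[bh _]
  /cutP[hc _]]]]|bc].
  by apply: t (t _ _ _ bh _) hc; rewrite inv.
(* A lost comparison has some [h x] with [b <= h x < c]. By invariance [h y] is the successor of
   [h x], so [h y <= c]. *)
have [Cbc|] := boolP ((b, c) \in cut R x); first by left.
rewrite inE bc negb_forall => /existsP[h];
  rewrite /= !negb_imply => /and3P[Hh bh nch].
have hc : (h x, c) \in R by case/orP: (u _ _ _ bh bc) => // ch;
  rewrite ch in nch.
have hyc : (h y, c) \in R.
  rewrite -[c](permKV h) inv //; apply: miny;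
    first by rewrite -(inv h) // permKV.
  by apply: contraNneq nch => e; rewrite -[c](permKV h) e.
(* Both halves survive the cut: [h x] is the only translate of [x] that can lie above [b], and none
   lies above [h y], as [h x <= h y <= k x] would force [k = h] and [y <= x]. *)
right; exists h => //; split; apply/cutP; split=> // k Hk.
  move=> bk; suff -> : k = h by [].
  by apply: (eq_shift (x := x) icoR Hk Hh); apply: u bh.
move=> hyk; have hxk : (h x, k x) \in R by apply: t hyk; rewrite inv.
have e : h = k by apply: (eq_shift (x := x) icoR Hh Hk);
  rewrite /same_chain hxk.
by case/negP: nyxR; rewrite -(inv h) // {2}e.
Qed.

(** * Counting invariant orders by their number of chains *)

Definition with_tops M := [set R in ico | #|tops R| == M].

Lemma with_topsP M R : reflect (R \in ico /\ #|tops R| = M) (R \in with_tops M).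
Proof. by apply: (iffP setIdP) => -[? /eqP]. Qed.

(** [M] counts chains, not orbits of chains; one joining step lowers it by [#|H|]. Both sides count
    the same configurations: [src] holds an order with a top and a bottom to be joined, [tgt] the
    joined order with the marked non-top [x], and [f] is a bijection with inverse given by
    [cut_succ]. *)
Lemma card_with_tops_rec M : #|H| <= M ->
  #|with_tops M| * (M * (M - #|H|)) = #|with_tops (M - #|H|)| * (#|T| - (M -
    #|H|)).
Proof.
move=> leHM.
pose src := [set s : {set T * T} * T * T |
  (s.1.1 \in with_tops M) && (s.1.2 \in tops s.1.1) &&
  ((s.2 \in bots s.1.1) && apart s.1.1 s.1.2 s.2)].
pose tgt := [set s : {set T * T} * T |
  (s.1 \in with_tops (M - #|H|)) && (s.2 \notin tops s.1)].
transitivity #|src|.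
  rewrite -[RHS]sum1_card; under [RHS]eq_bigl do rewrite inE.
  rewrite -(pair_big_dep (fun p => (p.1 \in with_tops M) && (p.2 \in tops p.1))
    (fun p y => (y \in bots p.1) && apart p.1 p.2 y) (fun _ _ => 1)) /=.
  rewrite -(pair_big_dep (mem (with_tops M)) (fun R x => x \in tops R)
    (fun R x => \sum_(y | (y \in bots R) && apart R x y) 1)) /=.
  rewrite -sum_nat_const; apply: eq_bigr => R /with_topsP[icoR <-].
  rewrite -sum_nat_const; apply: eq_bigr => x Tx.
  by rewrite -(card_apart icoR Tx) -sum1_card; apply: eq_bigl => y;
    rewrite in_set.
transitivity #|tgt|; last first.
  rewrite -sum1_card; under eq_bigl do rewrite inE.
  rewrite -(pair_big_dep (mem (with_tops (M - #|H|))) (fun R x =>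
    x \notin tops R)
    (fun _ _ => 1)) /= -sum_nat_const; apply: eq_bigr => R /with_topsP[_ <-].
  by rewrite -[tops R in RHS]setCK -cardsCs -sum1_card; apply: eq_bigl => x;
    rewrite in_setC.
pose f (s : {set T * T} * T * T) := (join s.1.1 s.1.2 s.2, s.1.2).
have srcP R x y : reflect [/\ R \in with_tops M, x \in tops R, y \in bots R &
  apart R x y]
    ((R, x, y) \in src).
  by rewrite [_ \in src]in_set /= -andbA; apply: and4P.
have tgtP R x : ((R, x) \in tgt) = (R \in with_tops (M - #|H|)) && (x \notin
  tops R).
  by rewrite [_ \in tgt]in_set.
have fI : {in src &, injective f}.
  move=> [[R x] y] [[R2 x2] y2] /srcP[/with_topsP[icoR _] Tx By ap].
  move=> /srcP[/with_topsP[icoR2 _] Tx2 By2 ap2] [eJ ex]; subst x2.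
  have eR : R = R2 by rewrite -(join_cutK icoR Tx By ap) eJ join_cutK.
  by subst R2; rewrite (join_inj icoR Tx By ap By2 ap2 eJ).
rewrite -(card_in_imset fI); congr #|pred_of_set _|; apply/setP=> -[R x].
rewrite tgtP; apply/imsetP/andP => [[[[R' x'] y]]|[/with_topsP[icoR MR] nTx]].
  case/srcP=> /with_topsP[icoR MR] Tx By ap [-> ->]; split.
    by apply/with_topsP; rewrite join_ico // card_tops_join // MR.
  rewrite tops_join // in_setD negb_and negbK; apply/orP; left.
  by apply/imsetP; exists 1%g; rewrite ?group1 ?perm1.
have [y [Tx By ap Rj]] := cut_succ icoR nTx.
have icoC := cut_ico x icoR.
exists (cut R x, x, y); last by rewrite /f /= Rj.
apply/srcP; split=> //; apply/with_topsP; split=> //.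
(* Cancelling the truncated subtraction requires at least [#|H|] tops in the cut order; the
   translates of [x] provide them. *)
have := card_tops_join icoC Tx By ap; rewrite Rj MR => /eqP.
rewrite eqn_sub2rE // => [/eqP //|].
rewrite -(card_orbH x); apply: subset_leq_card.
by apply/subsetP=> _ /imsetP[h Hh ->]; rewrite shift_top.
Qed.

(** When every point is a top, only the equality relation is left. *)
Lemma with_tops_card : #|with_tops #|T| | = 1.
Proof.
rewrite -(cards1 [set p : T * T | p.1 == p.2]); congr #|pred_of_set _|.
apply/setP=> R; rewrite in_set1; apply/with_topsP/eqP => [[icoR MR]|->].
  have allT x : x \in tops R.
    have /eqP -> : tops R == setT by rewrite eqEcard subsetT cardsT MR leqnn.
    by rewrite in_setT.
  have := icoR; rewrite inE => /andP[/chain_orderP[r _ _ _ _] _].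
  apply/setP=> -[x y]; rewrite inE /=; apply/idP/eqP => [xy|-> //].
  by have /topsP/(_ y xy) := allT x.
split; last first.
  rewrite -cardsT; congr #|pred_of_set _|; apply/setP=> x; rewrite in_setT.
  by apply/topsP=> y; rewrite inE => /eqP.
rewrite inE; apply/andP; split; last first.
  by apply/perm_invariantP=> h _ x y; rewrite !inE /= (inj_eq perm_inj).
apply/chain_orderP; split=> [x|x y|y x z|x y z|x y z];
  rewrite /same_chain !inE //=.
- by move/eqP.
- by move=> /eqP-> /eqP->.
- by move=> /eqP<- /eqP<-; rewrite eqxx.
- by move=> /eqP-> /eqP->; rewrite eqxx.
Qed.

(** By freeness, [A] splits into orbits of size [#|H|]. *)
Lemma dvdn_card_invariant (A : {set T}) :
  {in H & A, forall h x, h x \in A} -> #|H| %| #|A|.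
Proof.
move=> invA; have actA : [acts H, on A | 'P].
  apply/subsetP=> h Hh; rewrite inE in_setT inE.
  by apply/subsetP=> x Ax; rewrite inE /= apermE invA.
have /card_uniform_partition/(_ (orbit_partition actA))-> :
    {in orbit 'P H @: A, forall B : {set T}, #|B| = #|H|};
      last exact: dvdn_mull.
move=> _ /imsetP[x _ ->]; rewrite -(card_orbH x) /orbH.
by congr #|pred_of_set _|.
Qed.

Variable d : nat.
Hypotheses (card_T : #|T| = (d * #|H|)%N).

(** By freeness [d] is the number of orbits of [H] on [T]. The recursion is run downwards from
    [k = d], by induction on [d - k]; the factor [k!] on the left avoids division. *)
Lemma card_with_tops k : 0 < k <= d ->
  #|with_tops (k * #|H|)| * k`! = 'C(d.-1, k.-1) * d`! * #|H| ^ (d - k).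
Proof.
have m_gt0 : 0 < #|H| by apply: cardG_gt0.
case/andP=> k_gt0 /subnKC; move: (d - k) => j.
elim: j k k_gt0 => [|j IHj] k k_gt0 djk.
  rewrite addn0 in djk; rewrite djk -card_T with_tops_card.
  by rewrite binn expn0 !(mul1n, muln1).
have {IHj} := IHj k.+1 isT; rewrite addSnnS => /(_ djk) /= IH.
have dk : d - k = j.+1 by rewrite -djk addKn.
have := card_with_tops_rec (leq_pmull #|H| (ltn0Sn k)).
rewrite mulSn addKn card_T -mulnBl dk -mulSn => rec.
(* Multiplying by [(d - k) * #|H|] produces one side of the recursion [rec]. *)
apply/eqP; rewrite -(eqn_pmul2r (ltn0Sn j)) -(eqn_pmul2r m_gt0); apply/eqP.
have -> : #|with_tops (k * #|H|)| * k`! * j.+1 * #|H| =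
    (#|with_tops (k * #|H|)| * (j.+1 * #|H|)) * k`! by ring.
rewrite -rec.
have binE : k * 'C(d.-1, k) = j.+1 * 'C(d.-1, k.-1).
  have := mul_bin_left d.-1 k.-1; rewrite prednK // => ->.
  by rewrite -subn1 -(subn1 k) subnBA // subnK ?dk // -djk addnS.
have -> : #|with_tops (k.+1 * #|H|)| * (k.+1 * #|H| * (k * #|H|)) * k`! =
    (#|with_tops (k.+1 * #|H|)| * (k.+1 * k`!)) * (k * (#|H| * #|H|)).
  ring.
rewrite -factS IH expnS.
transitivity ((k * 'C(d.-1, k)) * d`! * #|H| ^ j * (#|H| * #|H|)); first ring.
by rewrite binE; ring.
Qed.

Lemma card_invariant_chain_orders : 0 < d ->
  #|ico| = \sum_(1 <= k < d.+1) #|with_tops (k * #|H|)|.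
Proof.
move=> d_gt0; have m_gt0 : 0 < #|H| by apply: cardG_gt0.
transitivity (\sum_(1 <= k < d.+1) \sum_(R in ico) (#|tops R| == k * #|H|));
  last first.
  apply: eq_bigr => k _; rewrite -[RHS]sum1_card big_mkcond [RHS]big_mkcond /=.
  by apply: eq_bigr => R _; rewrite [R \in with_tops _]inE; case: (R \in ico).
rewrite exchange_big /= -[LHS]sum1_card; apply: eq_bigr => R icoR.
(* Each order contributes to exactly one [k]: its tops form a nonempty [H]-stable set, so their
   number is [q * #|H|] with [1 <= q <= d]. *)
have /dvdnP[q qm] : #|H| %| #|tops R|.
  by apply: dvdn_card_invariant => h x Hh Tx; rewrite shift_top.
under eq_bigr do rewrite qm eqn_pmul2r // eq_sym.
have q_in : q \in index_iota 1 d.+1.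
  rewrite mem_index_iota ltnS -(@leq_pmul2r #|H| 1) // -(@leq_pmul2r #|H| q)
    // mul1n -qm -card_T max_card andbT.
  have /card_gt0P[x _] : 0 < #|T| by rewrite card_T muln_gt0 d_gt0.
  have [t Tt _] := top_above x (ico_chain icoR).
  rewrite dvdn_leq //.
    by apply/card_gt0P; exists t.
  by rewrite qm dvdn_mull.
rewrite (bigD1_seq q) ?iota_uniq //= eqxx big1 // => k /negPf ->.
by [].
Qed.

End Semiregular.

(** * Labeled crossings as chain orders *)

Lemma labeled_crossingsE n (c : crossing_data n) :
  (c \in labeled_crossings n) = chain_order c.2 && (c.1 == chains c.2).
Proof.
apply/idP/andP => [Lc | [cR /eqP c1E]].
  have [pP rf anti tr pb] := labeled_crossingsP Lc;
    have [/eqP covP tiP _] := and3P pP.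
  (* Strands of one part are always comparable and strands of different parts never are, so the
     order alone determines the parts. *)
  have pbE i j : (j \in pblock c.1 i) = same_chain c.2 i j by rewrite pb.
  have pbC i j k : same_chain c.2 i j -> same_chain c.2 i k ->
    same_chain c.2 j k.
    by rewrite -!pbE => /(same_pblock tiP) <-.
  split.
    apply/chain_orderP; split=> // [j i k|i j k ij ik|i j k ji ki];
      first exact: tr.
      by apply: (pbC i); rewrite /same_chain ?ij ?ik.
    by apply: (pbC i); rewrite /same_chain ?ji ?ki orbT.
  rewrite -{1}(equivalence_partition_pblock pP); apply/eqP.
  rewrite /equivalence_partition /chains; apply/setP=> B.
  apply/imsetP/imsetP => -[i _ ->]; exists i => //; apply/setP=> j;
    by rewrite !inE pbE.
have [rf anti tr u d] := chain_orderP _ cR.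
have eqv : {in setT & &, equivalence_rel (same_chain c.2)}.
  move=> i j k _ _ _; split; first by rewrite /same_chain rf.
  move=> ij; apply/idP/idP; last exact: same_chain_trans.
  by apply: same_chain_trans; rewrite // same_chainC.
have c1P : c.1 = equivalence_partition (same_chain c.2) setT.
  rewrite c1E /equivalence_partition /chains; apply/setP=> B.
  by apply/imsetP/imsetP => -[i _ ->]; exists i => //; apply/setP=> j;
    rewrite !inE.
rewrite inE c1P equivalence_partitionP //= -c1P c1E; apply/andP; split.
  apply/forall_inP=> _ /imsetP[b _ ->]; apply/linear_order_onP; split.
  - move=> i j; rewrite !inE => bi bj; apply: (same_chain_trans (y := b)) => //.
    by rewrite same_chainC.
  - by move=> i j _ _ /andP[]; apply: anti.
  - by move=> j i k _ _ _; apply: tr.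
apply/subsetP=> -[i j] ij; apply/bigcupP; exists (chain_of c.2 i).
  by apply/imsetP; exists i.
by rewrite !inE /same_chain rf ij.
Qed.

(** * The rotation action and Burnside's lemma *)

Section Rotation.

Variable n : nat.
Implicit Types (c : crossing_data n) (g h : {perm 'I_n}) (R : {set 'I_n *
  'I_n}).

Definition perm_rel g R := [set (g p.1, g p.2) | p in R].

(** Defined for all permutations of the strands, so that rotations act through a cyclic subgroup of
    the symmetric group. *)
Definition perm_crossing c g : crossing_data n :=
  ([set g @: B | B : {set 'I_n} in c.1], perm_rel g c.2).

Lemma perm_rel1 R : perm_rel 1 R = R.
Proof.
apply/setP=> -[i j]; apply/imsetP/idP => [[[a b] ab]|ij].
  by rewrite /= !perm1 => ->.
by exists (i, j); rewrite //= !perm1.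
Qed.

Lemma perm_relM g h R : perm_rel (g * h) R = perm_rel h (perm_rel g R).
Proof.
by rewrite /perm_rel -imset_comp; apply: eq_imset => p /=; rewrite !permM.
Qed.

Lemma mem_perm_rel g R i j : ((g i, g j) \in perm_rel g R) = ((i, j) \in R).
Proof.
apply/imsetP/idP => [[[a b] ab /= [/perm_inj-> /perm_inj->//]]|ij].
by exists (i, j).
Qed.

Lemma perm_crossing_is_action : is_action setT perm_crossing.
Proof.
apply: is_total_action => [[P R]|[P R] g h];
  rewrite /perm_crossing /= ?perm_rel1 ?perm_relM.
  congr pair; rewrite -[RHS]imset_id; apply: eq_imset => B.
  by rewrite -[RHS]imset_id; apply: eq_imset => i; rewrite perm1.
congr pair; rewrite -imset_comp; apply: eq_imset => B /=.
by rewrite -imset_comp; apply: eq_imset => i; rewrite permM.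
Qed.

Canonical perm_crossing_action := Action perm_crossing_is_action.

Lemma same_chain_perm_rel g R i j :
  same_chain (perm_rel g R) (g i) (g j) = same_chain R i j.
Proof. by rewrite /same_chain !mem_perm_rel. Qed.

Lemma perm_rel_chain g R : chain_order (perm_rel g R) = chain_order R.
Proof.
suff imp h Q : chain_order Q -> chain_order (perm_rel h Q).
  apply/idP/idP; last exact: imp.
  by move/(imp g^-1%g); rewrite -perm_relM mulgV perm_rel1.
case/chain_orderP=> r a t u d; have hK i := permKV h i.
apply/chain_orderP; split=> [i|i j|j i k|i j k|i j k].
- by rewrite -(hK i) mem_perm_rel.
- by rewrite -(hK i) -(hK j) !mem_perm_rel => /a /[apply] ->.
- by rewrite -(hK i) -(hK j) -(hK k) !mem_perm_rel; apply: t.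
- by rewrite -(hK i) -(hK j) -(hK k) !mem_perm_rel same_chain_perm_rel;
  apply: u.
- by rewrite -(hK i) -(hK j) -(hK k) !mem_perm_rel same_chain_perm_rel;
  apply: d.
Qed.

Lemma chains_perm_rel g R :
  chains (perm_rel g R) = [set g @: B | B : {set 'I_n} in chains R].
Proof.
have chE i : chain_of (perm_rel g R) (g i) = g @: chain_of R i.
  apply/setP=> j; rewrite -(permKV g j) inE same_chain_perm_rel.
  by rewrite mem_imset ?inE //; apply: perm_inj.
rewrite -imset_comp; apply/setP=> B; apply/imsetP/imsetP => -[i _ ->].
  by exists (g^-1%g i); rewrite // -{1}(permKV g i) chE.
by exists (g i); rewrite //= chE.
Qed.

Lemma perm_crossing_labeled c g :
  (perm_crossing c g \in labeled_crossings n) = (c \in labeled_crossings n).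
Proof.
rewrite !labeled_crossingsE /= perm_rel_chain chains_perm_rel; congr (_ && _).
by rewrite (inj_eq (imset_inj (imset_inj (@perm_inj _ g)))).
Qed.

(** Projection to the order component is injective on labeled crossings, and an order fixed by [g]
    is invariant under all powers of [g]. *)
Lemma card_fixed_crossings g :
  #|'Fix_(labeled_crossings n | perm_crossing_action)[g]%g| =
  #|invariant_chain_orders <[g]>%g|.
Proof.
have FixP c : reflect [/\ chain_order c.2, c.1 =
  chains c.2 & perm_rel g c.2 = c.2]
    (c \in 'Fix_(labeled_crossings n | perm_crossing_action)[g]%g).
  rewrite inE labeled_crossingsE; apply: (iffP andP) => [[/andP[cR /eqP cE]
    /afix1P/= e]|[cR cE e]].
    by split=> //; rewrite -{2}e.
  rewrite cR cE eqxx; split=> //; apply/afix1P;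
    case: c cR cE e => P R /= cR -> e.
  by rewrite /perm_crossing /= -chains_perm_rel e.
have snd_inj : {in 'Fix_(labeled_crossings n | perm_crossing_action)[g]%g &,
    injective (fun c : crossing_data n => c.2)}.
  by move=> [P R] [P' R'] /FixP[/= _ -> _] /FixP[/= _ -> _] ->.
rewrite -(card_in_imset snd_inj); apply: eq_card => R.
apply/imsetP/setIdP => [[c /FixP[cR _ e] ->]|[cR /perm_invariantP inv]].
  split=> //; apply/perm_invariantP=> h /cycleP[i ->] a b.
  elim: i a b => [|i IHi] a b; first by rewrite !perm1.
  by rewrite expgSr !permM -{1}e mem_perm_rel IHi.
exists (chains R, R) => //; apply/FixP; split=> //=.
by apply/setP=> -[a b]; rewrite -(permKV g a) -(permKV g b) mem_perm_rel
  [RHS]inv ?cycle_id.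
Qed.

Definition rotation : {perm 'I_n} := perm (@ordS_inj n).

Lemma shift_strandE r : @shift_strand n r =1 (rotation ^+ r)%g.
Proof.
by move=> i; rewrite permX /shift_strand; apply: eq_iter => j; rewrite permE.
Qed.

Lemma rotate_crossingE r c : rotate_crossing r c =
  perm_crossing c (rotation ^+ r).
Proof.
congr pair; apply: eq_imset => p /=; last by rewrite !shift_strandE.
by apply: eq_imset => i; rewrite shift_strandE.
Qed.

(** The criterion does not depend on [i]: this yields both the order [n] of the rotation and the
    freeness of the group it generates. *)
Lemma rotation_fix r i : ((rotation ^+ r)%g i == i) = (n %| r).
Proof.
rewrite -shift_strandE -val_eqE val_shift_strand.
by rewrite -[X in _ == X](modn_small (ltn_ord i)) -{2}[nat_of_ord i]addn0
  eqn_modDl mod0n.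
Qed.

Lemma rotation_expg_eq1 r : 0 < n -> ((rotation ^+ r)%g == 1%g) = (n %| r).
Proof.
move=> n_gt0; apply/eqP/idP => [e|nr]; last first.
  by apply/permP=> i; rewrite perm1; apply/eqP; rewrite rotation_fix.
by rewrite -(rotation_fix r (Ordinal n_gt0)) e perm1.
Qed.

Lemma order_rotation : 0 < n -> #[rotation]%g = n.
Proof.
move=> n_gt0; apply/eqP; rewrite eqn_dvd order_dvdn rotation_expg_eq1
  // dvdnn /=.
by rewrite -rotation_expg_eq1 // expg_order.
Qed.

Lemma rotation_semiregular h i : h \in <[rotation]>%g -> h i = i -> h = 1%g.
Proof.
case/cycleP=> r -> /eqP; have n_gt0 : 0 < n by case: (n) i => // -[].
by rewrite rotation_fix -rotation_expg_eq1 // => /eqP.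
Qed.

Lemma V_orbits : 0 < n ->
  V n = #|orbit perm_crossing_action <[rotation]>%g @: labeled_crossings n|.
Proof.
move=> n_gt0; congr #|pred_of_set _|; apply: eq_in_imset => c Lc.
apply/setP=> c'; rewrite inE; apply/andP/imsetP => [[_ /existsP[r /eqP->]]|].
  by exists (rotation ^+ r)%g; rewrite ?mem_cycle ?rotate_crossingE.
(* The exponent is taken below the order [n], since [same_up_to_rotation] quantifies over ['I_n]. *)
case=> _ /cyclePmin[r + ->] ->; rewrite order_rotation // => ltrn /=; split.
  by rewrite perm_crossing_labeled.
by apply/existsP; exists (Ordinal ltrn); rewrite rotate_crossingE.
Qed.

Lemma V_burnside : 0 < n ->
  \sum_(g in <[rotation]>%g) #|invariant_chain_orders <[g]>%g| = V n * n.
Proof.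
move=> n_gt0; rewrite V_orbits // -[X in _ * X](order_rotation n_gt0).
rewrite -Frobenius_Cauchy; last first.
  apply/subsetP=> g _; rewrite inE in_setT inE; apply/subsetP=> c Lc.
  by rewrite inE /= perm_crossing_labeled.
by apply: eq_bigr => g _; rewrite card_fixed_crossings.
Qed.

End Rotation.

(** * Sums over a cyclic group and the final formula *)

Lemma card_order_cycle (gT : finGroupType) (x : gT) e : e %| #[x]%g ->
  #|[set y in <[x]>%g | #[y]%g == e]| = totient e.
Proof.
(* [z] generates the unique subgroup of order [e] of the cyclic group, and the elements of order [e]
   are exactly its generators. *)
move=> dvd_e; pose z := (x ^+ (#[x] %/ e))%g.
have e_gt0 : 0 < e by apply: dvdn_gt0 dvd_e.
have oz : #[z]%g = e.
  rewrite orderXdiv ?dvdn_divl //; last by rewrite -{2}(divnK dvd_e) dvdn_mulr.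
  by rewrite divnA // mulKn.
rewrite -oz totient_gen; apply: eq_card => y; rewrite !inE /generator.
apply/andP/eqP => [[xy /eqP oy]|eqzy].
  apply/eqP; rewrite (eq_subG_cyclic (cycle_cyclic x)) ?cycle_subG ?mem_cycle
    //.
  by rewrite -!orderE oy.
rewrite !orderE eqzy eqxx -cycle_subG -eqzy cycle_subG mem_cycle; split=> //.
Qed.

Local Open Scope ring_scope.

(** Elements are grouped by the index [d] of the subgroup they generate; those of index [d] are the
    elements of order [#[x] %/ d]. *)
Lemma sum_cycle_order (gT : finGroupType) (x : gT) (F : nat -> rat) :
  \sum_(g in <[x]>%g) F (#[x]%g %/ #[g]%g)%N =
  \sum_(d <- divisors #[x]%g) (totient (#[x]%g %/ d))%:R * F d.
Proof.
transitivity (\sum_(g in <[x]>%g) \sum_(d <- divisors #[x]%g)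
    (d == #[x]%g %/ #[g]%g)%N%:R * F d).
  apply: eq_bigr => g xg; have dvd_g : (#[g]%g %| #[x]%g)%N by rewrite
    order_dvdG.
  rewrite (bigD1_seq (#[x]%g %/ #[g]%g)%N) ?divisors_uniq //=; last first.
    by rewrite -dvdn_divisors ?order_gt0 // dvdn_div.
  by rewrite eqxx mul1r big1 ?addr0 // => d /negPf ->; rewrite mul0r.
rewrite exchange_big /= big_seq_cond [RHS]big_seq_cond; apply: eq_bigr => d.
rewrite andbT -dvdn_divisors ?order_gt0 // => dvd_d.
rewrite -big_distrl /= -natr_sum; congr (_%:R * _).
rewrite -(@card_order_cycle _ x) ?dvdn_div
  // -sum1_card big_mkcond [RHS]big_mkcond.
apply: eq_bigr => g _; rewrite inE; case: ifP => //= xg.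
rewrite [in RHS]eqn_div ?(dvdn_gt0 (order_gt0 x) dvd_d) //.
by rewrite eqn_div ?order_gt0 ?order_dvdG // mulnC; case: eqP.
Qed.

Lemma card_invariant_chain_orders_rat (T : finType) (H : {group {perm T}}) (d :
  nat) :
    (forall h x, h \in H -> h x = x -> h = 1%g) -> #|T| = (d * #|H|)%N ->
      (0 < d)%N ->
  #|invariant_chain_orders H|%:R =
  \sum_(1 <= k < d.+1)
    'C(d - 1, k - 1)%:R * (d`!%:R / k`!%:R) * #|H|%:R ^+ (d - k) :> rat.
Proof.
move=> semireg cardT d_gt0; rewrite (card_invariant_chain_orders semireg cardT)
  // natr_sum.
rewrite big_nat_cond [RHS]big_nat_cond; apply: eq_bigr => k;
  rewrite andbT ltnS => kd.
have k_neq0 : k`!%:R != 0 :> rat by rewrite pnatr_eq0 -lt0n fact_gt0.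
apply: (mulIf k_neq0); rewrite -natrM (card_with_tops semireg cardT kd).
by rewrite !subn1 !natrM natrX; field.
Qed.

Theorem proposition4p1 (n : nat) (n_gt0 : (0 < n)%N) :
  (V n)%:R =
    n%:R^-1 *
    \sum_(d <- divisors n)
      (totient (n %/ d))%:R *
      \sum_(1 <= k < d.+1)
        'C(d - 1, k - 1)%:R * (d`!%:R / k`!%:R) * (n%:R / d%:R) ^+ (d - k)
  :> rat.
Proof.
have n_neq0 : n%:R != 0 :> rat by rewrite pnatr_eq0 -lt0n.
(* Clearing the factor [1/n] turns the left side into the Burnside sum. *)
apply: (mulIf n_neq0); rewrite -natrM -V_burnside // mulrC mulVKf // natr_sum.
have oR := order_rotation n_gt0.
rewrite -[in divisors n]oR; under [RHS]eq_bigr do rewrite -{1}oR.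
rewrite -sum_cycle_order oR; apply: eq_bigr => g Rg.
have := order_dvdG Rg; rewrite -orderE oR => dvd_g.
have d_gt0 : (0 < n %/ #[g]%g)%N by rewrite divn_gt0 // dvdn_leq.
rewrite (@card_invariant_chain_orders_rat _ _ (n %/ #[g]%g)) //.
- apply: eq_bigr => k _; congr (_ * _ ^+ _).
  (* With [d = n %/ #[g]], the rational quotient [n / d] is the order of [g]. *)
  have nE : n%:R = (n %/ #[g]%g)%:R * #[g]%g%:R :> rat by rewrite -natrM divnK.
  rewrite [X in _ = X / _]nE mulrC mulKf //.
  by rewrite pnatr_eq0 -lt0n.
- move=> h i gh; apply: rotation_semiregular.
  by move: gh; apply/subsetP; rewrite cycle_subG.
- by rewrite card_ord -orderE divnK.
Qed.
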